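(* Let $q'$ be a prime with $q'\leq 73$ and let $q=(q')^{6}$. Then for every odd codimension $r=2t+1\geq 3$ with $r\neq 9,13$ there exists a linear $[n_r,n_r-r]_q$ code $\mathcal{C}_r$ with covering radius $2$ and length $$n_r=\left(2+\frac{2}{\sqrt[6]{q}}+\frac{2}{\sqrt[3]{q}}+\frac{2}{\sqrt{q}}\right)q^{\frac{r-2}{2}}+2\left\lfloor q^{\frac{r-5}{2}}\right\rfloor,$$ and the family satisfies $$\liminf_{r\to\infty}\frac{V_q(n_r,2)}{q^{r}}<2+\frac{4}{\sqrt[6]{q}}+\frac{6}{\sqrt[3]{q}}+\frac{8}{\sqrt{q}}+\frac{6}{\sqrt[3]{q^{2}}}+\frac{5}{\sqrt[6]{q^{5}}}.$$
   Context: For a prime power $q$, an $[n,n-r]_q$ code is a linear subspace of $F_q^n$ of dimension $n-r$; it has covering radius $R$ if every column of $F_q^{r}$ is a linear combination of at most $R$ columns of a parity-check matrix, and $R$ is the smallest such integer. $V_q(n,R)=\sum_{i=0}^{R}(q-1)^i\binom{n}{i}$; $V_q(n,R)/q^r$ is the covering density of an $[n,n-r]_qR$ code. *)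

(* Defs.v *)
From HB Require Import structures.
From mathcomp Require Import all_boot all_order all_algebra.
From mathcomp Require Import all_classical all_reals all_analysis.
Set Implicit Arguments.
Unset Strict Implicit.
Unset Printing Implicit Defensive.
Import Order.TTheory GRing.Theory Num.Theory.
Local Open Scope ring_scope.

Section Codes.
Variables (F : finFieldType) (n r : nat).

Definition parity_check_matrix (C : {vspace 'rV[F]_n}) (H : 'M[F]_(r, n)) : Prop :=
  row_free H /\ forall x : 'rV[F]_n, (x \in C) = (H *m x^T == 0).

Definition covers (H : 'M[F]_(r, n)) (R : nat) : Prop :=
  forall s : 'cV[F]_r, exists (I : {set 'I_n}) (c : 'I_n -> F),
    (#|I| <= R)%N /\ s = \sum_(i in I) c i *: col i H.

(* Since H is determined up to left multiplication by an invertible matrix,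
   the choice of parity-check matrix is immaterial. *)
Definition covering_radius (C : {vspace 'rV[F]_n}) (R : nat) : Prop :=
  exists H : 'M[F]_(r, n), [/\ parity_check_matrix C H, covers H R
    & forall R' : nat, covers H R' -> (R <= R')%N].

(* C is an [n, n - r]_q R code, q = #|F|. The dimension is given by an addition
   because nat subtraction truncates. *)
Definition is_linear_code (C : {vspace 'rV[F]_n}) (R : nat) : Prop :=
  (\dim C + r = n)%N /\ covering_radius C R.

End Codes.

Arguments covering_radius {F n} r C R.
Arguments is_linear_code {F n} r C R.

Definition sphere_volume (q n R : nat) : nat :=
  (\sum_(0 <= i < R.+1) (q - 1) ^ i * 'C(n, i))%N.

Definition covering_density (K : realType) (q n r R : nat) : K :=
  (sphere_volume q n R)%:R / q%:R ^+ r.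

Definition nroot (K : realType) (k : nat) (x : K) : K := x `^ (k%:R^-1).

(* Main.v *)
(* Idea.  Write p = q', k = F_p and K = F_(p^3) inside F = F_q.  The k-linear sets
   {(x, x^p, c)} and {(y, d, g y)} of PG(2, K), with x, y in K and c, d in k, have
   rank 4, so by counting each of them meets every line of PG(2, K).  For a suitable
   additive bijection g of K they are disjoint; hence every line of PG(2, K) contains
   two distinct points of their union, and since every point of PG(2, F) lies on (the
   extension of) a line of PG(2, K), these 2(p^3 + p^2 + p + 1) points form a
   1-saturating set, which is the case r = 3.

   Disjointness of the two sets means that g (z^(p-1)) <> z^p for all z <> 0 in K.
   One chooses g so that z |-> g (z^(p-1)) / z^p takes the value 1 twice; it is then
   not onto K^*, and one divides g by a value that is missed.

   Larger codimensions come from q^m-concatenation: a column h_j is replaced by the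
   q^m columns (h_j, xi, beta_j xi), where beta_j ranges over F_(q^m) and infinity.
   Columns are coloured, every nonzero vector has to be a combination of exactly two
   columns of different colours, and beta has to separate the colours and to be onto.
   Then the same holds for the new columns, with twice as many colours.  Such a beta
   exists when q^m + 1 lies between the numbers of colours and of columns; starting
   from r = 5 this reaches every odd r except 9 and 13.  The step from r = 3 to r = 5
   has too few columns and takes two extra ones. *)

Require Import Defs.
From HB Require Import structures.
From mathcomp Require Import all_boot all_order all_algebra all_fingroup all_field.
From mathcomp Require Import ring lra zify.
Set Implicit Arguments.
Unset Strict Implicit.
Unset Printing Implicit Defensive.
Import Order.TTheory GRing.Theory Num.Theory.
Local Open Scope ring_scope.

(** * A product on F_(q^m) *)

(** In a splitting field of [X^(q^m) - X] over [F], the roots are the fixed points of the [m]-th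
    power of the Frobenius generator [a]. They form a subfield, and counting them gives its
    degree. *)
Lemma fieldExt_of_degree (F : finFieldType) (m : nat) : (0 < m)%N ->
  exists E : fieldExtType F, \dim {:E} = m.
Proof.
move=> m_gt0; set q := #|F|.
have q_gt1 : (1 < q)%N := finNzRing_gt1 F.
have qm_gt1 : (1 < q ^ m)%N by rewrite -{1}(exp1n m) ltn_exp2r.
pose P (R : nzRingType) : {poly R} := 'X^(q ^ m) - 'X.
have szP (R : nzRingType) : size (P R) = (q ^ m).+1.
  by rewrite size_polyDl size_polyXn // size_polyN size_polyX.
have nzP : P F != 0 by rewrite -size_poly_eq0 szP.
have [L [zs]] := FinSplittingFieldFor nzP.
rewrite rmorphB /= map_polyXn map_polyX -/(P L) => DP _.
have qL0 : q%:R = 0 :> L.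
  have [p p_pr pF] := finPcharP F.
  have pL : p \in [pchar L] by rewrite pchar_lalg.
  rewrite /q (card_pprimeChar pF) natrX (pcharf0 pL) expr0n.
  case: (logn _ _) (card_pprimeChar pF) => // e1; move: q_gt1.
  by rewrite /q e1.
have Uzs : uniq zs.
  rewrite -separable_prod_XsubC -(eqp_separable DP) unlock.
  (* As [q = 0] in [L] and [m > 0], the derivative is a nonzero constant, so the [q^m] roots are
     distinct. *)
  have -> : (P L)^`() = - 1.
    rewrite derivB derivXn derivX -mulr_natr natrX.
    rewrite -[q%:R]polyC_natr qL0 expr0n -leqn0 leqNgt m_gt0 mulr0 sub0r //.
  by rewrite -scaleN1r coprimepZr ?coprimep1 // oppr_eq0 oner_eq0.
have [a _ Da] := finField_galois_generator (sub1v {:L}).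
exists (subvs_of (fixedField [set (a ^+ m)%g])%AS); rewrite dimvf.
change (\dim (fixedField [set (a ^+ m)%g]) = m).
have Dfix x : (x \in fixedField [set (a ^+ m)%g]) = (x ^+ (q ^ m) == x).
  have aE k y : (a ^+ k)%g y = y ^+ (q ^ k).
    elim: k => [|k IHk]; first by rewrite gal_id expr1.
    by rewrite expgSr expnSr exprM galM ?memvf // IHk Da ?memvf // dimv1 expn1.
  apply/(fixedFieldP (memvf x))/eqP => [/(_ _ (set11 _))|xm _ /set1P->];
  by rewrite aE ?xm.
pose Lf := FinFieldExtType L.
have := @card_vspace F Lf _ (fixedField [set (a ^+ m)%g]).
rewrite (@eq_card Lf _ (mem zs)) => [|x]; last first.
  by rewrite Dfix -root_prod_XsubC -(eqp_root DP) rootE !hornerE subr_eq0.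
have -> : #|(mem zs : pred Lf)| = (q ^ m)%N.
  rewrite (@card_uniqP Lf _ Uzs); apply: succn_inj.
  by rewrite -(size_prod_XsubC _ id) -(eqp_size DP) szP.
by move/eqP; rewrite eqn_exp2l // => /eqP <-.
Qed.

Section Presemifield.
Import passmx.

(* The product of F_(q^m), in coordinates over F. *)
Lemma presemifield_exists (F : finFieldType) (m : nat) : (0 < m)%N ->
  exists mul : 'rV[F]_m -> 'rV[F]_m -> 'rV[F]_m,
    [/\ forall a, linear (mul a), forall b, {morph mul^~ b : x y / x - y}
      & forall a b, mul a b = 0 -> a = 0 \/ b = 0].
Proof.
move=> /(fieldExt_of_degree F) [E <-].
have eB := vbasisP {:E}; set e := vbasis _ in eB.
exists (fun a b => rVof e (vecof e a * vecof e b)); split => [a k x y|b x y|a b].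
- by rewrite linearP mulrDr -scalerAr linearP.
- by rewrite linearB mulrBl linearB.
move/eqP; rewrite rVof_eq0 // mulf_eq0 !vecof_eq0 //.
by move=> /orP[]/eqP->; [left|right].
Qed.

End Presemifield.

(** * The fixed fields of powers of the Frobenius map *)

(** Subtracting a fixed element of a fibre embeds that fibre in the kernel. *)
Lemma card_additive_kernel (V : finZmodType) (W : finZmodType) (A : {set V})
    (f : V -> W) :
    {in A &, forall x y, x - y \in A} -> {in A &, {morph f : x y / x - y}} ->
  (#|A| <= #|[set x in A | f x == 0%R]| * #|f @: A|)%N.
Proof.
move=> subA fB; rewrite -sum1_card (partition_big_imset f) /= mulnC -sum_nat_const.
apply: leq_sum => b /imsetP[a Aa ->]; rewrite sum1dep_card.
have inj : {in [set x in A | f x == f a] &, injective (fun x => x - a)}.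
  by move=> x y _ _ /addIr.
rewrite -(card_in_imset inj); apply/subset_leq_card/subsetP => _ /imsetP[x + ->].
by rewrite !inE => /andP[Ax /eqP fx]; rewrite subA // fB // fx subrr /=.
Qed.

Lemma pigeonhole_on (T T' : finType) (A : {set T}) (B : {set T'}) (f : T -> T') :
    (forall x, x \in A -> f x \in B) -> (#|B| < #|A|)%N ->
  exists x y, [/\ x \in A, y \in A, x != y & f x = f y].
Proof.
move=> fAB ltBA; have : ~~ dinjectiveb f A.
  apply: contraL ltBA => /dinjectiveP/card_in_imset <-.
  by rewrite -leqNgt; apply/subset_leq_card/subsetP => _ /imsetP[x /fAB ? ->].
by case/dinjectivePn => x xA [y] /andP[yx yA] fxy; exists x, y; rewrite eq_sym.
Qed.

Lemma card_poly_roots (F : finFieldType) (P : {poly F}) n :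
  P != 0 -> (size P <= n.+1)%N -> (#|[set x | root P x]| <= n)%N.
Proof.
move=> P0 szP; rewrite -ltnS cardE; apply: leq_trans szP.
apply: max_poly_roots => //; last exact: enum_uniq.
by apply/allP => x; rewrite mem_enum inE.
Qed.

Section FixedFields.

Variables (F : finFieldType) (p : nat).
Hypotheses (pF : p \in [pchar F]).

Let p_prime : prime p := pcharf_prime pF.
Let p_gt1 : (1 < p)%N := prime_gt1 p_prime.

Definition frobfix n : {set F} := [set x | x ^+ (p ^ n) == x].

Lemma frobfixP n x : reflect (x ^+ (p ^ n) = x) (x \in frobfix n).
Proof. by rewrite inE; apply: eqP. Qed.

Lemma pchar_nat_exp n : [pchar F].-nat (p ^ n)%N.
Proof. by rewrite pnatX pnatE ?pF. Qed.

Lemma exprD_pchar n (x y : F) : (x + y) ^+ (p ^ n) = x ^+ (p ^ n) + y ^+ (p ^ n).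
Proof. exact/exprDn_pchar/pchar_nat_exp. Qed.

Lemma exprB_pchar n (x y : F) : (x - y) ^+ (p ^ n) = x ^+ (p ^ n) - y ^+ (p ^ n).
Proof. by rewrite exprD_pchar exprNn_pchar ?pchar_nat_exp. Qed.

Lemma frobfix1 n : 1 \in frobfix n. Proof. by apply/frobfixP; rewrite expr1n. Qed.
Lemma frobfix0 n : 0 \in frobfix n.
Proof. by apply/frobfixP; rewrite expr0n expn_eq0; case: p p_gt1. Qed.
Lemma frobfixB n x y : x \in frobfix n -> y \in frobfix n -> x - y \in frobfix n.
Proof. by move=> /frobfixP xn /frobfixP yn; apply/frobfixP; rewrite exprB_pchar xn yn. Qed.
Lemma frobfixN n x : x \in frobfix n -> - x \in frobfix n.
Proof. by move=> xn; rewrite -sub0r frobfixB ?frobfix0. Qed.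
Lemma frobfixD n x y : x \in frobfix n -> y \in frobfix n -> x + y \in frobfix n.
Proof. by move=> xn yn; rewrite -[y]opprK frobfixB ?frobfixN. Qed.
Lemma frobfixM n x y : x \in frobfix n -> y \in frobfix n -> x * y \in frobfix n.
Proof. by move=> /frobfixP xn /frobfixP yn; apply/frobfixP; rewrite exprMn xn yn. Qed.
Lemma frobfixV n x : x \in frobfix n -> x^-1 \in frobfix n.
Proof. by move=> /frobfixP xn; apply/frobfixP; rewrite exprVn xn. Qed.
Lemma frobfixX n x e : x \in frobfix n -> x ^+ e \in frobfix n.
Proof. by move=> /frobfixP xn; apply/frobfixP; rewrite exprAC xn. Qed.
Lemma frobfixS n x : x \in frobfix 1 -> x \in frobfix n.
Proof.
move=> /frobfixP; rewrite expn1 => xp; apply/frobfixP.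
by elim: n => [|n IHn]; rewrite ?expr1 // expnS exprM xp.
Qed.

Lemma card_frobfix_le n : (0 < n)%N -> (#|frobfix n| <= p ^ n)%N.
Proof.
move=> n_gt0; have pn_gt1 : (1 < p ^ n)%N by rewrite -(exp1n n) ltn_exp2r.
have sz : size ('X^(p ^ n) - 'X : {poly F}) = (p ^ n).+1.
  by rewrite size_polyDl size_polyXn // size_polyN size_polyX.
have <- : [set x : F | root ('X^(p ^ n) - 'X) x] = frobfix n.
  by apply/setP => x; rewrite !inE rootE !hornerE subr_eq0.
by apply: card_poly_roots; rewrite -?size_poly_eq0 sz.
Qed.

(** For the lower bound, [x^(p^3) - x] is additive with kernel [frobfix 3]. By [x^(p^6) = x], its
    values are roots of [X^(p^3) + X], so there are at most [p^3] of them. *)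
Lemma card_frobfix3 : #|F| = (p ^ 6)%N -> #|frobfix 3| = (p ^ 3)%N.
Proof.
move=> cF; apply/eqP; rewrite eqn_leq card_frobfix_le //=.
have p3_gt1 : (1 < p ^ 3)%N by rewrite -(exp1n 3) ltn_exp2r.
have fB : {in [set: F] &, {morph (fun x => x ^+ (p ^ 3) - x) : x y / x - y}}.
  by move=> x y _ _ /=; rewrite exprB_pchar; move: (x ^+ _) (y ^+ _) => a b; ring.
have := card_additive_kernel (fun _ _ _ _ => in_setT _) fB.
have -> : [set x in [set: F] | x ^+ (p ^ 3) - x == 0] = frobfix 3.
  by apply/setP => x; rewrite !inE subr_eq0.
rewrite cardsT cF [(p ^ 6)%N](expnD p 3 3).
have im : (#|[set (x ^+ (p ^ 3) - x)%R | x in [set: F]]| <= p ^ 3)%N.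
  have sz : size ('X^(p ^ 3) + 'X : {poly F}) = (p ^ 3).+1.
    by rewrite size_polyDl size_polyXn // size_polyX.
  have := @card_poly_roots F ('X^(p ^ 3) + 'X) (p ^ 3).
  rewrite -size_poly_eq0 sz => /(_ isT (leqnn _)); apply: leq_trans.
  apply/subset_leq_card/subsetP => _ /imsetP[x _ ->].
  rewrite inE rootE !hornerE exprB_pchar -exprM -expnD -cF expf_card.
  by rewrite /= subrK subrr.
move=> /leq_trans/(_ (leq_mul (leqnn _) im)); rewrite leq_pmul2r //.
exact: ltnW.
Qed.

(** The same count inside [frobfix 3]: the values of [x^p - x] have trace zero, hence are roots of
    [X^(p^2) + X^p + X]. *)
Lemma card_frobfix1 : #|F| = (p ^ 6)%N -> #|frobfix 1| = p.
Proof.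
move=> cF; apply/eqP; rewrite eqn_leq -{1}(expn1 p) card_frobfix_le //=.
have fB : {in frobfix 3 &, {morph (fun x => x ^+ p - x) : x y / x - y}}.
  move=> x y _ _ /=; rewrite -{1}[p]expn1 exprB_pchar expn1.
  by move: (x ^+ _) (y ^+ _) => a b; ring.
have := card_additive_kernel (@frobfixB 3) fB.
have -> : [set x in frobfix 3 | x ^+ p - x == 0] = frobfix 1.
  apply/setP => x; rewrite in_set subr_eq0 -{1}[p]expn1.
  apply/andP/frobfixP => [[_ /eqP //]|xp]; rewrite frobfixS ?xp //; exact/frobfixP.
rewrite card_frobfix3 // (expnD p 1 2).
have im : (#|[set (x ^+ p - x)%R | x in frobfix 3]| <= p ^ 2)%N.
  have p2 : (p < p ^ 2)%N by rewrite -{1}[p]expn1 ltn_exp2l.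
  have sz : size ('X^(p ^ 2) + ('X^p + 'X) : {poly F}) = (p ^ 2).+1.
    rewrite size_polyDl size_polyXn // ltnS; apply: leq_trans (size_polyD _ _) _.
    by rewrite size_polyXn size_polyX geq_max p2 (ltn_trans p_gt1).
  have := @card_poly_roots F _ (p ^ 2) _ (eq_leq sz).
  rewrite -size_poly_eq0 sz => /(_ isT); apply: leq_trans.
  apply/subset_leq_card/subsetP => _ /imsetP[x /frobfixP xK ->].
  have xpp : (x ^+ p - x) ^+ p = x ^+ (p ^ 2) - x ^+ p.
    by have := exprB_pchar 1 (x ^+ p) x; rewrite expn1 -exprM.
  rewrite inE rootE !hornerE /= xpp exprB_pchar -exprM -expnS xK.
  by apply/eqP; move: (x ^+ _) (x ^+ _) => a b; ring.
move=> /leq_trans/(_ (leq_mul (leqnn _) im)); rewrite expn1 leq_pmul2r //.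
by rewrite expn_gt0 ltnW.
Qed.

End FixedFields.

(** * The twisting map g *)

Section Twist.

Variables (F : finFieldType) (p : nat).
Hypotheses (pF : p \in [pchar F]) (cF : #|F| = (p ^ 6)%N).

Let p_prime : prime p := pcharf_prime pF.
Let p_gt1 : (1 < p)%N := prime_gt1 p_prime.
Let p_gt0 : (0 < p)%N := prime_gt0 p_prime.
Local Notation K := (frobfix F p 3).
Local Notation k := (frobfix F p 1).

Lemma frobD (x y : F) : (x + y) ^+ p = x ^+ p + y ^+ p.
Proof. by have := exprD_pchar pF 1 x y; rewrite expn1. Qed.

Lemma frobB (x y : F) : (x - y) ^+ p = x ^+ p - y ^+ p.
Proof. by have := exprB_pchar pF 1 x y; rewrite expn1. Qed.

Lemma frobfix1P (x : F) : reflect (x ^+ p = x) (x \in k).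
Proof. by rewrite inE expn1; apply: eqP. Qed.

(** If [z] is outside [k] but [c = z^(p-1)] is in [k], then [z + 1] works: with [d = (z+1)^(p-1)] in
    [k], the relation [c z + 1 = d (z + 1)] would put [z] in [k]. *)
Lemma exists_generic_element :
  exists2 z : F, z \in K & (z \notin k) && (z ^+ p.-1 \notin k).
Proof.
have [z zK zk] : exists2 z, z \in K & z \notin k.
  have : ~~ (K \subset k).
    apply: contraTN (ltn_exp2l 1 3 p_gt1) => /subset_leq_card.
    by rewrite (card_frobfix1 pF cF) (card_frobfix3 pF cF) expn1 -leqNgt.
  by case/subsetPn => z; exists z.
have frobE (x : F) : x ^+ p = x ^+ p.-1 * x by rewrite -exprSr prednK.
case: (boolP (z ^+ p.-1 \in k)) => [ck|]; last by move=> ck; exists z; rewrite ?zk.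
have z1k : z + 1 \notin k.
  by apply: contra zk => z1; rewrite -[z](addrK 1) (frobfixB pF) // frobfix1.
exists (z + 1); first by rewrite (frobfixD pF) // frobfix1.
rewrite z1k /=; apply/negP => dk.
have zc := frobE z; have := frobE (z + 1).
rewrite frobD {1}zc expr1n.
have {frobE} : forall c d : F, c \in k -> d \in k -> z ^+ p = c * z ->
  c * z + 1 = d * (z + 1) -> False; last by move=> /(_ _ _ ck dk zc).
move=> {ck dk zc} c d ck dk zc cd.
have [cd0|cd0] := eqVneq (c - d) 0.
  move/eqP: cd0 zc cd; rewrite subr_eq0 => /eqP-> zc.
  rewrite mulrDr mulr1 => /addrI d1; case/negP: zk; apply/frobfix1P.
  by rewrite zc -d1 mul1r.
case/negP: zk; have -> : z = (d - 1) / (c - d).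
  by apply: (mulIf cd0); rewrite divfK //; apply/eqP; rewrite -subr_eq0; apply/eqP;
  have -> : z * (c - d) - (d - 1) = (c * z + 1) - d * (z + 1); [ring|rewrite cd subrr].
by rewrite frobfixM ?frobfixV ?(frobfixB pF) // frobfix1.
Qed.

(* A [k]-linear form on [K]: the Moore determinant of [1, v, y]. *)
Definition moore (v y : F) :=
  (v ^+ p - v) * (y ^+ p - y) ^+ p - (v ^+ p - v) ^+ p * (y ^+ p - y).

Lemma mooreB v : {morph moore v : x y / x - y}.
Proof.
by move=> x y; rewrite /moore !frobB; move: (x ^+ _) (y ^+ _) (v ^+ _) => a b c; ring.
Qed.

Lemma mooreZ v c y : c \in k -> moore v (c * y) = c * moore v y.
Proof.
by move=> /frobfix1P ck; rewrite /moore exprMn ck -!mulrBr !exprMn ck; ring.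
Qed.

Lemma moore1 v : moore v 1 = 0.
Proof. by rewrite /moore expr1n subrr expr0n eqn0Ngt p_gt0 !mulr0 subrr. Qed.

(** An element [u = x^p - x] with [x] in [K] satisfies [u^(p^2) = -u - u^p]; substituting this in
    the [p]-th power of the determinant returns the determinant. *)
Lemma moore_frobfix1 v y : v \in K -> y \in K -> moore v y \in k.
Proof.
move=> vK yK; apply/frobfix1P; rewrite /moore frobB !exprMn.
have tr0 (x : F) : x \in K -> (x ^+ p - x) ^+ p ^+ p = - (x ^+ p - x) - (x ^+ p - x) ^+ p.
  move=> /frobfixP xK; have xp : x ^+ p ^+ p ^+ p = x.
    by rewrite -!exprM -[RHS]xK !expnS expn0 muln1 mulnA.
  by rewrite !frobB xp; move: (x ^+ p ^+ p) (x ^+ p) => a b; ring.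
by rewrite !tr0 //; move: ((v ^+ p - v) ^+ p) ((y ^+ p - y) ^+ p) => a b; ring.
Qed.

(** If the determinant vanishes, [c = (v^p - v) / (y^p - y)] is fixed by Frobenius, and so is
    [v - c y]; thus [v] lies in [k + k y]. *)
Lemma moore_neq0 v y : y \notin k -> v \notin [set ab.1 + ab.2 * y | ab in setX k k] ->
  moore v y != 0.
Proof.
move=> yk vy; apply/negP => /eqP m0.
have Y0 : y ^+ p - y != 0 by rewrite subr_eq0; apply: contra yk => /eqP/frobfix1P.
pose c := (v ^+ p - v) / (y ^+ p - y).
have ck : c \in k.
  apply/frobfix1P; rewrite /c exprMn exprVn; apply/eqP; rewrite eqr_div ?expf_neq0 //.
  by apply/eqP; apply/esym/eqP; rewrite -subr_eq0; apply/eqP.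
case/negP: vy; apply/imsetP; exists (v - c * y, c) => /=; last by rewrite subrK.
rewrite inE /= ck andbT; apply/frobfix1P; rewrite frobB exprMn (frobfix1P _ ck).
have -> : v ^+ p = v + c * (y ^+ p - y) by rewrite divfK // addrC subrK.
by ring.
Qed.

Lemma exists_twist : exists g : F -> F,
  [/\ {in K, forall y, g y \in K}, {morph g : x y / x - y},
      {in k, forall c y, g (c * y) = c * g y},
      {in K, forall y, g y = 0 -> y = 0}
    & {in K, forall z, z != 0 -> g (z ^+ p.-1) != z ^+ p}].
Proof.
have [z zK /andP[zk wk]] := exists_generic_element.
pose w := z ^+ p.-1; pose w' := z ^+ p.
have wK : w \in K by rewrite frobfixX.
have w'K : w' \in K by rewrite frobfixX.
have z0 : z != 0 by apply: contraNneq zk => ->; rewrite frobfix0.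
have w'k : w' \notin k.
  apply: contra zk => /frobfix1P; rewrite /w' => zpp; apply/frobfix1P.
  apply/eqP; rewrite -subr_eq0; have := expf_eq0 (z ^+ p - z) p.
  by rewrite frobB zpp subrr eqxx p_gt0 => /esym.
pose span1 y := [set ab.1 + ab.2 * y | ab in setX k k].
have card_span y : (#|span1 y| <= p ^ 2)%N.
  by rewrite (leq_trans (leq_imset_card _ _)) // cardsX (card_frobfix1 pF cF).
have span0 y : 0 \in span1 y.
  by apply/imsetP; exists (0, 0); rewrite ?in_setX ?frobfix0 //= mul0r addr0.
(* The two spans share [0] and have at most [p^2] elements each, so their union has fewer than
   [2 p^2 <= p^3] elements and cannot contain [K]. *)
have [v vK] : exists2 v, v \in K & v \notin span1 w :|: span1 w'.
  suff /subsetPn[v vK vn] : ~~ (K \subset span1 w :|: span1 w') by exists v.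
  apply/negP => /subset_leq_card; rewrite (card_frobfix3 pF cF).
  have : (0 < #|span1 w :&: span1 w'|)%N.
    by apply/card_gt0P; exists 0; rewrite inE !span0.
  have := cardsUI (span1 w) (span1 w'); have := card_span w; have := card_span w'.
  have : (2 * p ^ 2 <= p ^ 3)%N by rewrite [(p ^ 3)%N]expnS leq_mul2r p_gt1 orbT.
  move: (p ^ 2)%N (p ^ 3)%N #|_ :|: _| #|_ :&: _| => a b c d; lia.
rewrite inE => /norP[vw vw'].
have sw0 := moore_neq0 wk vw; have sw'0 := moore_neq0 w'k vw'.
pose s := moore v; rewrite -/(s w) -/(s w') in sw0 sw'0.
have sk y : y \in K -> s y \in k by move=> yK; apply: moore_frobfix1.
have sB : {morph s : x y / x - y} := mooreB v.
have sZ c y : c \in k -> s (c * y) = c * s y := @mooreZ v c y.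
(* A rank-one perturbation of the identity. It fixes [1], where [s] vanishes, and sends [w] to [w'];
   [s w' != 0] will make it injective on [K]. *)
pose g0 y := y + (w' - w) * (s y / s w).
have tK y : y \in K -> s y / s w \in k.
  by move=> yK; rewrite frobfixM ?frobfixV ?sk.
have g0K : {in K, forall y, g0 y \in K}.
  by move=> y yK; rewrite (frobfixD pF) // frobfixM ?(frobfixB pF) // frobfixS ?tK.
have g0B : {morph g0 : x y / x - y}.
  by move=> x y; rewrite /g0 sB; move: (s x) (s y) (s w)^-1 => a b c; ring.
have g0Z : {in k, forall c y, g0 (c * y) = c * g0 y}.
  by move=> c ck y; rewrite /g0 sZ //; move: (s w)^-1 => d; ring.
have g0_inj : {in K, forall y, g0 y = 0 -> y = 0}.
  move=> y yK; rewrite /g0 => gy; have tk := tK y yK; have t_def := divfK sw0 (s y).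
  move: (s y / s w) tk t_def gy => t tk t_def gy.
  have y_def : y = t * w - t * w' by apply/eqP; rewrite -subr_eq0 -gy; apply/eqP; ring.
  have : t * s w' = 0.
    have := congr1 s y_def; rewrite sB !sZ // -t_def => /eqP.
    by rewrite -subr_eq0 opprB addrC subrK => /eqP.
  move/eqP; rewrite mulf_eq0 (negPf sw'0) orbF => /eqP t0.
  by rewrite y_def t0 !mul0r subrr.
have g01 : g0 1 = 1 by rewrite /g0 /s moore1 mul0r mulr0 addr0.
have g0w : g0 w = w' by rewrite /g0 divff // mulr1 addrC subrK.
(* [phi 1 = phi z], so [phi] is not onto the nonzero elements of [K]. *)
pose phi x := g0 (x ^+ p.-1) / x ^+ p.
have phiK x : x \in K :\ 0 -> phi x \in K :\ 0.
  rewrite !in_setD1 => /andP[x0 xK]; apply/andP; split; last first.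
    by rewrite /phi frobfixM ?frobfixV ?frobfixX ?g0K ?frobfixX.
  rewrite mulf_neq0 ?invr_eq0 ?expf_neq0 //.
  apply: contra x0 => /eqP/g0_inj/eqP; rewrite frobfixX // expf_eq0.
  by move=> /(_ isT)/andP[].
have z1 : z != 1 by apply: contraNneq zk => ->; rewrite frobfix1.
have [m mK phim] : exists2 m, m \in K :\ 0 & m \notin phi @: (K :\ 0).
  suff /subsetPn[m ? ?] : ~~ (K :\ 0 \subset phi @: (K :\ 0)) by exists m.
  apply/negP => /subset_leq_card; rewrite leqNgt => /negP; apply.
  rewrite ltn_neqAle leq_imset_card andbT; apply/imset_injP => /(_ 1 z).
  rewrite !in_setD1 oner_eq0 frobfix1 z0 zK => /(_ isT isT) e.
  by move: z1; rewrite -e ?eqxx // /phi !expr1n g01 -/w -/w' g0w !divff ?expf_neq0 ?oner_eq0.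
move: mK; rewrite in_setD1 => /andP[m0 mK].
exists (fun y => m^-1 * g0 y); split=> [y yK|x y|c ck y|y yK|x xK x0].
- by rewrite frobfixM ?frobfixV ?g0K.
- by rewrite g0B mulrBr.
- by rewrite g0Z // mulrCA.
- by move/eqP; rewrite mulf_eq0 invr_eq0 (negPf m0) => /eqP/g0_inj->.
apply: contra phim => /eqP e; apply/imsetP; exists x; first by rewrite in_setD1 x0.
rewrite /phi; apply: (mulIf (expf_neq0 p x0)); rewrite divfK ?expf_neq0 // -e.
by rewrite mulVKf.
Qed.

End Twist.

(** * Linear sets in the plane *)

(** A 1-saturating property with exactly two columns. The nonzero coefficients and the different
    colours are what the concatenation uses: the former are inverted, the latter force different
    slopes. *)
Definition spread (F : finFieldType) r (J : finType) (T : eqType)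
    (h : J -> 'rV[F]_r) (col : J -> T) :=
  forall a, a != 0 -> exists i j x y,
    [/\ x != 0, y != 0, col i != col j & a = x *: h i + y *: h j].

Definition vec3 (F : finFieldType) (x y z : F) : 'rV[F]_3 := \row_i [:: x; y; z]`_i.

Section Vec3.
Variable F : finFieldType.
Implicit Types x y z : F.

Lemma vec3D x y z x' y' z' :
  vec3 x y z + vec3 x' y' z' = vec3 (x + x') (y + y') (z + z').
Proof. by apply/rowP => -[[|[|[|//]]] i3]; rewrite !mxE. Qed.

Lemma vec3Z a x y z : a *: vec3 x y z = vec3 (a * x) (a * y) (a * z).
Proof. by apply/rowP => -[[|[|[|//]]] i3]; rewrite !mxE. Qed.

Lemma vec3_inj x y z x' y' z' :
  vec3 x y z = vec3 x' y' z' -> [/\ x = x', y = y' & z = z'].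
Proof.
move=> /rowP e; have := (e ord0, e (inord 1), e (inord 2)).
by rewrite !mxE !inordK //= => -[[-> ->] ->].
Qed.

Lemma vec3_eq0 x y z : (vec3 x y z == 0) = [&& x == 0, y == 0 & z == 0].
Proof.
have -> : 0 = vec3 0 0 0 :> 'rV[F]_3 by apply/rowP => -[[|[|[|//]]] i3]; rewrite !mxE.
by apply/eqP/and3P => [/vec3_inj[-> -> ->]|[/eqP-> /eqP-> /eqP->]].
Qed.

(* [P], [u] and [w] all annihilate [n], so their determinant vanishes. *)
Lemma orthogonal_plane (a b c : F) (P u w : 'rV[F]_3) (n := vec3 a b c) :
    n != 0 -> P *m n^T = 0 -> u *m n^T = 0 -> w *m n^T = 0 ->
    (forall s t, s *: u + t *: w = 0 -> s = 0 /\ t = 0) ->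
  exists s t, P = s *: u + t *: w.
Proof.
move=> n0 Pn un wn indep.
pose M := col_mx P (col_mx u w) : 'M_(1 + (1 + 1)).
have Mn : M *m n^T = 0.
  by rewrite !mul_col_mx Pn un wn !col_mx0.
have /eqP/det0P[l l0] : \det M = 0.
  rewrite -det_tr; apply/eqP/det0P; exists n => //.
  by apply: trmx_inj; rewrite trmx_mul trmxK Mn trmx0.
rewrite -[l]hsubmxK -[rsubmx l]hsubmxK /M !mul_row_col.
set l1 := lsubmx l; set l2 := lsubmx (rsubmx l); set l3 := rsubmx (rsubmx l).
rewrite [l1]mx11_scalar [l2]mx11_scalar [l3]mx11_scalar !mul_scalar_mx.
move: (l1 0 0) (l2 0 0) (l3 0 0) (mx11_scalar l1) (mx11_scalar l2) (mx11_scalar l3).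
move=> x y z l1E l2E l3E lM.
have [x0|x0] := eqVneq x 0.
  move: lM; rewrite x0 scale0r add0r => /indep[y0 z0].
  case/eqP: l0; rewrite -[l]hsubmxK -[rsubmx l]hsubmxK -/l1 -/l2 -/l3.
  by rewrite l1E l2E l3E x0 y0 z0 (raddf0 (@scalar_mx F 1)) !row_mx0.
exists (- (x^-1 * y)), (- (x^-1 * z)).
have -> : P = x^-1 *: (x *: P) by rewrite scalerK.
have -> : x *: P = - (y *: u + z *: w) by apply/eqP; rewrite -addr_eq0 lM.
by rewrite scalerN scalerDr !scalerA opprD !scaleNr.
Qed.

End Vec3.

Section LinearSet.

Variables (F : finFieldType) (p : nat).
Hypotheses (pF : p \in [pchar F]) (cF : #|F| = (p ^ 6)%N).
Let p_prime : prime p := pcharf_prime pF.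
Let p_gt1 : (1 < p)%N := prime_gt1 p_prime.
Local Notation K := (frobfix F p 3).
Local Notation k := (frobfix F p 1).

Variable f : F -> F.
Hypothesis fB : {morph f : x y / x - y}.
Hypothesis fZ : {in k, forall c y, f (c * y) = c * f y}.

Definition slopes := [set f x / x | x in K :\ 0].
(* The points [(x, f x, 1)] and, at infinity, [(1, f x / x, 0)] of the linear set
   [{(x, f x, c)}]. *)
Definition lpoint := ({x | x \in K} + {s | s \in slopes})%type.

Definition affine_lpoint x (xK : x \in K) : lpoint :=
  inl (exist (fun x => x \in K) x xK).
Definition ideal_lpoint s (sS : s \in slopes) : lpoint :=
  inr (exist (fun s => s \in slopes) s sS).

(** Scaling [x] by a nonzero element of [k] keeps [f x / x], so each slope comes from at least
    [p - 1] of the [p^3 - 1 = (p^2 + p + 1)(p - 1)] nonzero elements of [K]. *)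
Lemma card_slopes : (#|slopes| <= p ^ 2 + p + 1)%N.
Proof.
have k1 : #|k :\ 0| = p.-1.
  by have := cardsD1 0 k; rewrite (card_frobfix1 pF cF) frobfix0 // add1n => /(congr1 predn).
have K1 : #|K :\ 0| = (p ^ 3).-1.
  by have := cardsD1 0 K; rewrite (card_frobfix3 pF cF) frobfix0 // add1n => /(congr1 predn).
have : (#|slopes| * p.-1 <= #|K :\ 0%R|)%N.
  rewrite /slopes -sum_nat_const -[X in (_ <= X)%N]sum1_card.
  rewrite [X in (_ <= X)%N](partition_big_imset (fun x => f x / x)) /=.
apply: leq_sum => _ /imsetP[x xK ->]; rewrite sum1dep_card -k1.
  move: xK; rewrite in_setD1 => /andP[x0 xK].
  rewrite -(card_in_imset (f := fun c => c * x)); last first.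
    by move=> c d _ _; apply: mulIf.
  apply/subset_leq_card/subsetP => _ /imsetP[c + ->].
  rewrite in_setD1 => /andP[c0 ck].
  have cxK : c * x \in K by rewrite frobfixM // frobfixS.
  by rewrite in_set in_setD1 mulf_neq0 // cxK /= fZ // -mulf_div divff // mul1r.
rewrite K1; have -> : (p ^ 3).-1 = ((p ^ 2 + p + 1) * p.-1)%N.
  by case: p p_gt1 => // n _; rewrite /= !expnS expn0; nia.
by rewrite leq_mul2r; case: p p_gt1 => [|[]].
Qed.

Lemma card_lpoint : (#|{: lpoint}| <= p ^ 3 + p ^ 2 + p + 1)%N.
Proof.
rewrite card_sum !card_sig -!addnA (addnA (p ^ 2)%N).
by rewrite leq_add ?(leq_trans _ card_slopes) // -(card_frobfix3 pF cF).
Qed.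

Variable v : F -> F -> F -> 'rV[F]_3.
Hypothesis vD : forall x y z x' y' z',
  v x y z + v x' y' z' = v (x + x') (y + y') (z + z').
Hypothesis vZ : forall a x y z, a *: v x y z = v (a * x) (a * y) (a * z).

(** The coordinate map [v] is a parameter because the second linear set is read with its last two
    coordinates exchanged. *)
Definition lcol (i : lpoint) : 'rV[F]_3 :=
  match i with inl x => v (val x) (f (val x)) 1 | inr s => v 1 (val s) 0 end.

Lemma lcol_cover x c : x \in K -> c \in k -> (x != 0) || (c != 0) ->
  exists i d, d != 0 /\ v x (f x) c = d *: lcol i.
Proof.
move=> xK ck xc; have [c0|c0] := eqVneq c 0.
  move: xc; rewrite c0 eqxx orbF => x0.
  have xs : f x / x \in slopes by apply/imset_f; rewrite in_setD1 x0.
  exists (ideal_lpoint xs), x; split=> //=.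
  by rewrite vZ mulr1 mulr0 mulrC divfK.
have xcK : c^-1 * x \in K by rewrite frobfixM ?frobfixV // frobfixS.
exists (affine_lpoint xcK), c; split=> //=.
by rewrite vZ fZ ?frobfixV // !mulVKf // mulr1.
Qed.

(** Handles vectors proportional to a single column, for which two columns are still required. An
    affine point is split by the point at [x + 1] and the ideal point of slope [f 1]; an ideal point
    is a multiple of the difference of the affine points at [x] and [0]. *)
Lemma lcol_split i : exists i1 i2 a b,
  [/\ a != 0, b != 0, i1 != i2 & lcol i = a *: lcol i1 + b *: lcol i2].
Proof.
case: i => [[x xK]|[s sS]].
  have x1K : x + 1 \in K by rewrite (frobfixD pF) ?frobfix1.
  have s1 : f 1 / 1 \in slopes by apply/imset_f; rewrite in_setD1 oner_eq0 frobfix1.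
  exists (affine_lpoint x1K), (ideal_lpoint s1), 1, (-1).
  split; rewrite ?oppr_eq0 ?oner_eq0 //= divr1 !vZ vD.
  have fx : f x = f (x + 1) - f 1 by rewrite -fB addrK.
  by rewrite fx; congr v; ring.
have /imsetP[x] := sS; rewrite in_setD1 => /andP[x0 xK] s_def.
have K0 : 0 \in K by rewrite frobfix0.
exists (affine_lpoint xK), (affine_lpoint K0), x^-1, (- x^-1).
split; rewrite ?oppr_eq0 ?invr_eq0 //=.
have f0 : f 0 = 0 by rewrite -[X in f X](subrr 0) fB subrr.
by rewrite !vZ vD s_def f0; congr v; field.
Qed.

End LinearSet.

(** * A 1-saturating set in the projective plane *)

Section Saturating.

Variables (F : finFieldType) (p : nat).
Hypotheses (pF : p \in [pchar F]) (cF : #|F| = (p ^ 6)%N).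
Let p_prime : prime p := pcharf_prime pF.
Let p_gt1 : (1 < p)%N := prime_gt1 p_prime.
Local Notation K := (frobfix F p 3).
Local Notation k := (frobfix F p 1).

(** The [p^9] triples over [K] have only [p^6] possible products with [P]; the difference of two
    triples with equal product is the line sought. *)
Lemma point_on_subline (P : 'rV[F]_3) : exists a b c,
  [/\ a \in K, b \in K, c \in K, vec3 a b c != 0 & P *m (vec3 a b c)^T = 0].
Proof.
pose A : {set F * (F * F)} := setX K (setX K K).
pose dot (n : F * (F * F)) : F :=
  P 0 0 * n.1 + (P 0 (inord 1) * n.2.1 + P 0 (inord 2) * n.2.2).
have [||m [n [mA nA mn dmn]]] := @pigeonhole_on _ _ A [set: F] dot.
- by move=> x _; rewrite in_setT.
- by rewrite cardsT cF !cardsX !(card_frobfix3 pF cF) -!expnD ltn_exp2l.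
have dn : dot (m - n) = 0.
  by apply/eqP; rewrite -(subrr (dot n)) -{1}dmn; apply/eqP; rewrite /dot /=; ring.
have : m - n != 0 by rewrite subr_eq0.
have : m - n \in A.
  case: m mA {mn dmn dn} => ? [? ?]; case: n nA => ? [? ?].
  rewrite !in_setX => /and3P[? ? ?] /and3P[? ? ?].
  by rewrite !(frobfixB pF).
case: (m - n) dn => x [y z] dn; rewrite !in_setX /= => /and3P[xK yK zK] n0.
exists x, y, z; split=> //; first by rewrite vec3_eq0.
apply/matrixP => i j; rewrite !ord1 !mxE !big_ord_recl big_ord0 addr0 !mxE /=.
rewrite -[RHS]dn /dot /=; congr (_ * _ + (P 0 _ * _ + P 0 _ * _));
  by apply: val_inj; rewrite /= ?inordK.
Qed.

(** The [p^4] pairs [(x, c)] in [K] times [k] yield at most [p^3] values in [K], and the product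
    with [n] is additive in the pair. *)
Lemma linear_set_meets_line (f : F -> F) (v : F -> F -> F -> 'rV[F]_3)
    (n : 'rV[F]_3) :
    {in K, forall x, f x \in K} -> {morph f : x y / x - y} ->
    (forall x y z x' y' z', v x y z - v x' y' z' = v (x - x') (y - y') (z - z')) ->
    (forall x y z, x \in K -> y \in K -> z \in K -> (v x y z *m n^T) 0 0 \in K) ->
  exists x c, [/\ x \in K, c \in k, (x != 0) || (c != 0) & v x (f x) c *m n^T = 0].
Proof.
move=> fK fB vB nK.
pose dot (u : F * F) : F := (v u.1 (f u.1) u.2 *m n^T) 0 0.
have [||u [w [uA wA uw duw]]] := @pigeonhole_on _ _ (setX K k) K dot.
- by move=> [x y]; rewrite in_setX => /andP[? ?]; rewrite nK ?fK // frobfixS.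
- by rewrite cardsX (card_frobfix3 pF cF) (card_frobfix1 pF cF) -expnSr ltn_exp2l.
have dn : dot (u - w) = 0.
  by rewrite /dot /= fB -vB mulmxBl mxE -/(dot u) duw [X in _ + X]mxE subrr.
have : u - w != 0 by rewrite subr_eq0.
have : u - w \in setX K k.
  case: u uA {uw duw dn} => ? ?; case: w wA => ? ?.
  by rewrite !in_setX => /andP[? ?] /andP[? ?]; rewrite !(frobfixB pF).
case: (u - w) dn => x c dn; rewrite in_setX /= => /andP[xK ck] n0.
exists x, c; split=> //; last by apply/matrixP => i j; rewrite !ord1 [RHS]mxE.
by rewrite -negb_and.
Qed.

Lemma linear_sets_saturate (g : F -> F) (P : 'rV[F]_3) :
    {in K, forall y, g y \in K} -> {morph g : x y / x - y} ->
    {in k, forall c y, g (c * y) = c * g y} ->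
    {in K, forall y, g y = 0 -> y = 0} ->
    {in K, forall z, z != 0 -> g (z ^+ p.-1) != z ^+ p} ->
  exists x c y d s t, [/\ x \in K, c \in k, y \in K & d \in k] /\
    [/\ (x != 0) || (c != 0), (y != 0) || (d != 0)
      & P = s *: vec3 x (x ^+ p) c + t *: vec3 y d (g y)].
Proof.
move=> gK gB gZ g_inj g_ne.
have [a [b [c [aK bK cK n0 Pn]]]] := point_on_subline P.
have dotK x y z : x \in K -> y \in K -> z \in K ->
    (vec3 x y z *m (vec3 a b c)^T) 0 0 \in K.
  move=> xK yK zK; rewrite !mxE !big_ord_recl big_ord0 addr0 !mxE /=.
  by rewrite !(frobfixD pF) ?frobfixM.
have vB (x y z x' y' z' : F) : vec3 x y z - vec3 x' y' z' = vec3 (x - x') (y - y') (z - z').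
  by rewrite -scaleN1r vec3Z vec3D !mulN1r.
have [||||x [c1 [xK ck xc un]]] :=
  @linear_set_meets_line (fun x => x ^+ p) (@vec3 F) (vec3 a b c).
- by move=> x xK; rewrite frobfixX.
- exact: frobB pF.
- exact: vB.
- exact: dotK.
have [||y [d [yK dk yd wn]]] :=
  @linear_set_meets_line g (fun x y z => vec3 x z y) (vec3 a b c) gK gB.
- by move=> *; apply: vB.
- by move=> *; apply: dotK.
have g0 : g 0 = 0 by rewrite -[X in g X](subrr 0) gB subrr.
(* Disjointness of the two sets. When [c1], [d] and [x] are nonzero, proportionality makes
   [z = c1 / x] satisfy [z^(p-1) = y / d] and [z^p = g y / d], against the choice of [g]. *)
have indep l : l *: vec3 x (x ^+ p) c1 = vec3 y d (g y) -> False.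
  rewrite vec3Z => /vec3_inj[lx lxp lc].
  have [d0|d0] := eqVneq d 0.
    have l0 : l != 0.
      by apply: contraTneq yd => l0; rewrite -lx l0 mul0r eqxx d0 eqxx.
    have x0 : x = 0.
      apply/eqP; move/eqP: lxp; rewrite d0 mulf_eq0 (negPf l0) /= expf_eq0.
      by case/andP.
    by move: yd; rewrite -lx x0 mulr0 eqxx d0 eqxx.
  have [c0|c0] := eqVneq c1 0.
    move: lc; rewrite c0 mulr0 => /esym/(g_inj _ yK) y0.
    have x0 : x != 0 by move: xc; rewrite c0 eqxx orbF.
    move/eqP: lx; rewrite y0 mulf_eq0 (negPf x0) orbF => /eqP l0.
    by move: d0; rewrite -lxp l0 mul0r eqxx.
  have x0 : x != 0.
    by apply: contraNneq d0 => x0; rewrite -lxp x0 expr0n gtn_eqF ?mulr0 // ltnW.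
  have zK : c1 / x \in K by rewrite frobfixM // ?frobfixV // frobfixS.
  have := g_ne _ zK; rewrite mulf_neq0 ?invr_eq0 // => /(_ isT)/eqP; apply.
  have pE (z : F) : z ^+ p = z * z ^+ p.-1 by rewrite -exprS prednK // ltnW.
  have c1p : c1 ^+ p.-1 = 1.
    by apply: (mulfI c0); rewrite -pE mulr1; apply/(frobfix1P p).
  have -> : (c1 / x) ^+ p.-1 = d^-1 * y.
    rewrite exprMn c1p mul1r exprVn -lx -lxp pE.
    by field; rewrite x0 expf_neq0 //; apply: contraNneq d0 => l0; rewrite -lxp l0 mul0r.
  rewrite gZ ?frobfixV // -lc exprMn exprVn (frobfix1P p _ ck) -lxp.
  by field; rewrite expf_neq0 //; apply: contraNneq d0 => l0; rewrite -lxp l0 mul0r.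
have [|s [t Pst]] := orthogonal_plane n0 Pn un wn; last first.
  by exists x, c1, y, d, s, t.
move=> s t st; have u0 : vec3 x (x ^+ p) c1 != 0.
  by rewrite vec3_eq0; move: xc; case: eqP => //= _ /negPf->; rewrite andbF.
have w0 : vec3 y d (g y) != 0.
  by rewrite vec3_eq0; move: yd; case: eqP => //= _ /negPf->.
have [t0|t0] := eqVneq t 0.
  move/eqP: st; rewrite t0 scale0r addr0 scaler_eq0 (negPf u0) orbF.
  by move/eqP.
case: (indep (- (t^-1 * s))); apply: (scalerI t0); rewrite scalerA mulrN mulVKf //.
by rewrite scaleNr; apply/eqP; rewrite eqr_oppLR -addr_eq0 st.
Qed.

(* The two sides of the disjoint union carry the linear sets
   [{(x, x^p, c)}] and [{(y, d, g y)}]. *)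
Lemma plane_spread : exists (J : finType) (h : J -> 'rV[F]_3),
  (#|J| <= 2 * (p ^ 3 + p ^ 2 + p + 1))%N /\ spread h id.
Proof.
have [g [gK gB gZ g_inj g_ne]] := exists_twist pF cF.
have fB : {morph (fun x : F => x ^+ p) : x y / x - y} := frobB pF.
have fZ : {in k, forall c y : F, (c * y) ^+ p = c * y ^+ p}.
  by move=> c /(frobfix1P p) ck y; rewrite exprMn ck.
pose U := lpoint p (fun x : F => x ^+ p); pose W := lpoint p g.
pose v2 (x y z : F) := vec3 x z y.
have v2D x y z x' y' z' : v2 x y z + v2 x' y' z' = v2 (x + x') (y + y') (z + z').
  exact: vec3D.
have v2Z a x y z : a *: v2 x y z = v2 (a * x) (a * y) (a * z) by apply: vec3Z.
pose hU : U -> 'rV_3 := lcol (@vec3 F); pose hW : W -> 'rV_3 := lcol v2.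
exists (U + W)%type, (fun i => match i with inl u => hU u | inr w => hW w end); split.
  by rewrite card_sum mul2n -addnn leq_add ?card_lpoint.
move=> P P0; have [x [c [y [d [s [t [[xK ck yK dk] [xc yd PE]]]]]]]] :=
  linear_sets_saturate P gK gB gZ g_inj g_ne.
have [i [a [a0 uE]]] := lcol_cover fZ (@vec3Z F) xK ck xc.
have [j [b [b0 wE]]] := lcol_cover gZ v2Z yK dk yd.
rewrite uE -[vec3 y d (g y)]/(v2 y (g y) d) wE !scalerA in PE.
(* If one coefficient vanishes, [P] is a multiple of one column, which is then split inside its own
   linear set. *)
have [s0|s0] := eqVneq s 0.
  rewrite s0 mul0r scale0r add0r in PE.
  have [j1 [j2 [e1 [e2 [e10 e20 j12 jE]]]]] := lcol_split pF gB v2D v2Z j.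
  have tb0 : t * b != 0 by apply: contraNneq P0 => tb0; rewrite PE tb0 scale0r.
  exists (inr j1), (inr j2), (t * b * e1), (t * b * e2).
  split; rewrite ?(mulf_neq0 tb0) //; last by rewrite PE jE scalerDr !scalerA.
have [t0|t0] := eqVneq t 0.
  rewrite t0 mul0r scale0r addr0 in PE.
  have [j1 [j2 [e1 [e2 [e10 e20 j12 jE]]]]] := lcol_split pF fB (@vec3D F) (@vec3Z F) i.
  exists (inl j1), (inl j2), (s * a * e1), (s * a * e2).
  split; rewrite ?mulf_neq0 //; last by rewrite PE jE scalerDr !scalerA.
by exists (inl i), (inr j), (s * a), (t * b); split; rewrite ?mulf_neq0.
Qed.

End Saturating.

(** * Concatenation *)

(** Choose [#|B|] elements of [J] that include a representative of each colour that occurs. They are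
    matched bijectively with [B], and every other element follows the representative of its
    colour. *)
Lemma coloring_refinement (J T B : finType) (col : J -> T) :
    (0 < #|B|)%N -> (#|T| <= #|B|)%N -> (#|B| <= #|J|)%N ->
  exists beta : J -> B, (forall b, exists j, beta j = b) /\
    (forall i j, beta i = beta j -> col i = col j).
Proof.
move=> B_gt0 leTB leBJ.
have /card_gt0P[j0 _] : (0 < #|J|)%N := leq_trans B_gt0 leBJ.
have /card_gt0P[b0 _] := B_gt0.
pose phi t := odflt j0 [pick i | col i == t].
have phiK j : col (phi (col j)) = col j.
  by rewrite /phi; case: pickP => [i /eqP //|/(_ j)]; rewrite eqxx.
pose R := [set phi (col j) | j : J].
have leRB : (#|R| <= #|B|)%N.
  apply: leq_trans leTB; apply: leq_trans (leq_imset_card phi _).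
  by apply/subset_leq_card/subsetP => _ /imsetP[j _ ->]; apply: imset_f.
pose E := enum R ++ enum (~: R); pose S := take #|B| E.
have sE : size E = #|J| by rewrite size_cat -!cardE cardsC.
have sS : size S = #|B| by rewrite size_takel // sE.
have uS : uniq S.
  rewrite take_uniq // cat_uniq !enum_uniq andbT /=.
  by apply/hasPn => j; rewrite !mem_enum inE.
have RS j : j \in R -> j \in S.
  rewrite -mem_enum => jR; rewrite /S take_cat; case: ltnP => [|_]; last first.
    by rewrite mem_cat jR.
  by rewrite -cardE ltnNge leRB.
pose rep j := if j \in S then j else phi (col j).
have repS j : rep j \in S by rewrite /rep; case: ifP => // _; apply/RS/imset_f.
have colrep j : col (rep j) = col j by rewrite /rep; case: ifP.
exists (fun j => nth b0 (enum B) (index (rep j) S)); split=> [b|i j].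
  have iB : (index b (enum B) < size S)%N by rewrite sS cardE index_mem mem_enum.
  exists (nth j0 S (index b (enum B))).
  by rewrite /rep mem_nth // index_uniq // nth_index // mem_enum.
move/eqP; rewrite nth_uniq ?enum_uniq -?cardE -?sS ?index_mem // => /eqP ij.
by rewrite -(colrep i) -(colrep j) -(nth_index j0 (repS i)) ij nth_index.
Qed.

Section Lift.

Variables (F : finFieldType) (m : nat) (mul : 'rV[F]_m -> 'rV[F]_m -> 'rV[F]_m).
Hypothesis mul_linear : forall a, linear (mul a).
Hypothesis mulB : forall b, {morph mul^~ b : x y / x - y}.
Hypothesis mul_eq0 : forall a b, mul a b = 0 -> a = 0 \/ b = 0.

(* The line of slope [beta] through the origin of [F_Q ^ 2], parametrised by
   [F_Q]; [None] is the vertical line. *)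
Definition slope_line (beta : option 'rV[F]_m) (xi : 'rV[F]_m) : 'rV[F]_(m + m) :=
  if beta is Some b then row_mx xi (mul b xi) else row_mx 0 xi.

Lemma mulr_sub a x y : mul a (x - y) = mul a x - mul a y.
Proof. by rewrite addrC -scaleN1r mul_linear scaleN1r addrC. Qed.

Lemma mul_scale a k x : mul a (k *: x) = k *: mul a x.
Proof.
have mul0 : mul a 0 = 0 by have := mulr_sub a 0 0; rewrite !subrr.
by rewrite -[k *: x]addr0 mul_linear mul0 addr0.
Qed.

Lemma slope_lineZ beta k xi : slope_line beta (k *: xi) = k *: slope_line beta xi.
Proof. by case: beta => [b|]; rewrite /= scale_row_mx ?scaler0 ?mul_scale. Qed.

Lemma slope_lineB beta xi eta :
  slope_line beta (xi - eta) = slope_line beta xi - slope_line beta eta.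
Proof.
by case: beta => [b|]; rewrite /= opp_row_mx add_row_mx ?subrr ?mulr_sub.
Qed.

Lemma slope_line0 beta : slope_line beta 0 = 0.
Proof. by have := slope_lineB beta 0 0; rewrite !subrr. Qed.

Lemma mul_surj a y : a != 0 -> exists x, mul a x = y.
Proof.
move=> a0; have inj : injective (mul a).
  move=> x x' e; apply/eqP; rewrite -subr_eq0; apply/eqP.
  have /mul_eq0[/eqP|//] : mul a (x - x') = 0 by rewrite mulr_sub e subrr.
  by rewrite (negPf a0).
by have [g _ gK] := injF_bij inj; exists (g y).
Qed.

Lemma slope_line_cover (v : 'rV[F]_(m + m)) : exists beta xi, v = slope_line beta xi.
Proof.
rewrite -[v]hsubmxK; have [b0|b0] := eqVneq (lsubmx v) 0.
  by exists None, (rsubmx v); rewrite b0.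
have inj : injective (mul^~ (lsubmx v)).
  move=> x x' e; apply/eqP; rewrite -subr_eq0; apply/eqP.
  have /mul_eq0[//|/eqP] : mul (x - x') (lsubmx v) = 0 by rewrite mulB e subrr.
  by rewrite (negPf b0).
have [g _ gK] := injF_bij inj.
by exists (Some (g (rsubmx v))), (lsubmx v); rewrite /= gK.
Qed.

(** Two distinct lines through the origin are complementary: for slopes [a] and [a'], one solves
    [(a - a') x = c - a' b]. *)
Lemma slope_lines_span beta beta' (v : 'rV[F]_(m + m)) : beta != beta' ->
  exists xi eta, v = slope_line beta xi + slope_line beta' eta.
Proof.
move=> bb'; rewrite -[v]hsubmxK; set b := lsubmx v; set c := rsubmx v.
case: beta beta' bb' => [a|] [a'|] //= bb'.
- have [|x ax] := @mul_surj (a - a') (c - mul a' b).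
    by rewrite subr_eq0; apply: contraNneq bb' => ->.
  exists x, (b - x); rewrite add_row_mx addrC subrK; congr row_mx.
  by rewrite mulr_sub addrCA addrC -mulB ax subrK.
- by exists b, (c - mul a b); rewrite add_row_mx addr0 addrC subrK.
- by exists (c - mul a' b), b; rewrite add_row_mx add0r subrK.
Qed.

Variables (r : nat) (J : finType) (T : eqType).
Variables (h : J -> 'rV[F]_r) (col : J -> T) (beta : J -> option 'rV[F]_m).

Definition lift_col (u : J * 'rV[F]_m) : 'rV[F]_(r + (m + m)) :=
  row_mx (h u.1) (slope_line (beta u.1) u.2).

Hypothesis h_spread : spread h col.
Hypothesis beta_sep : forall i j, beta i = beta j -> col i = col j.

Lemma lift_cover a (v : 'rV[F]_(m + m)) : a != 0 -> exists i j x y,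
  [/\ x != 0, y != 0, col i.1 != col j.1
    & row_mx a v = x *: lift_col i + y *: lift_col j].
Proof.
move=> /h_spread[i [j [x [y [x0 y0 ij ->]]]]].
have bij : beta i != beta j by apply: contra ij => /eqP/beta_sep->.
have [xi [eta ->]] := slope_lines_span v bij.
exists (i, x^-1 *: xi), (j, y^-1 *: eta), x, y; split=> //.
by rewrite !scale_row_mx add_row_mx /= -!slope_lineZ !scalerA !divff // !scale1r.
Qed.

Lemma lift_col_slope j v :
  row_mx 0 (slope_line (beta j) v) = 1 *: lift_col (j, v) + (-1) *: lift_col (j, 0).
Proof.
rewrite scale1r scaleN1r opp_row_mx add_row_mx /= subrr.
by rewrite -slope_lineB subr0.
Qed.

(** If the top part is zero, the vector lies on the line of some column [j] and is the difference of
    the new columns [(j, xi)] and [(j, 0)]. These share the old colour, whence the extra bit that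
    doubles the number of colours. *)
Lemma lift_spread : (forall b, exists j, beta j = b) ->
  spread lift_col (fun u => (col u.1, u.2 == 0)).
Proof.
move=> beta_surj v v0; rewrite -[v]hsubmxK; have [a0|a0] := eqVneq (lsubmx v) 0.
  have [b [xi wE]] := slope_line_cover (rsubmx v); have [j bj] := beta_surj b.
  have xi0 : xi != 0.
    apply: contraNneq v0 => xi0; rewrite -[v]hsubmxK a0 wE xi0.
    by rewrite slope_line0 row_mx0.
  exists (j, xi), (j, 0), 1, (-1); rewrite oppr_eq0 !oner_eq0 a0 wE -bj lift_col_slope.
  by split; rewrite // xpair_eqE /= !eqxx (negPf xi0).
have [i [j [x [y [x0 y0 ij e]]]]] := lift_cover (rsubmx v) a0.
by exists i, j, x, y; rewrite e; split=> //; rewrite xpair_eqE (negPf ij).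
Qed.

(* When [beta] is not onto, two further columns make up for the lines through the
   origin of [F_q ^ 2] that are missed. *)
Definition extended_col (u : J * 'rV[F]_m + bool) : 'rV[F]_(r + (m + m)) :=
  match u with
  | inl u => lift_col u
  | inr b => row_mx 0 (slope_line (if b then Some 0 else None) (const_mx 1))
  end.

(* When [beta] is not onto, two further columns make up for the lines through the
   origin of [F_q ^ 2] that are missed. *)
Definition extended_color (u : J * 'rV[F]_m + bool) : T * bool + bool :=
  match u with inl u => inl (col u.1, u.2 == 0) | inr b => inr b end.

Lemma extended_spread : m = 1%N -> (exists j, beta j = Some 0) ->
  (exists j, beta j = None) -> spread extended_col extended_color.
Proof.
move=> m1 [j1 b1] [j2 b2] v v0; rewrite -[v]hsubmxK.
have const (x : 'rV[F]_m) : exists k, x = k *: const_mx 1.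
  move: x; rewrite m1 => x; exists (x 0 0); apply/rowP => i.
  by rewrite !mxE ord1 mulr1.
have [a0|a0] := eqVneq (lsubmx v) 0; last first.
  have [i [j [x [y [x0 y0 ij e]]]]] := lift_cover (rsubmx v) a0.
  exists (inl i), (inl j), x, y; rewrite e; split=> //=.
  by apply: contra ij => /eqP[->].
rewrite a0; have one_slope j w : beta j = w -> forall xi, xi != 0 ->
    exists i1 i2 x y, [/\ x != 0, y != 0, extended_color i1 != extended_color i2
      & row_mx 0 (slope_line w xi) = x *: extended_col i1 + y *: extended_col i2].
  move=> <- xi xi0; exists (inl (j, xi)), (inl (j, 0)), 1, (-1).
  rewrite oppr_eq0 !oner_eq0 lift_col_slope /=; split=> //.
  by apply/eqP => -[] /esym; rewrite eqxx (negPf xi0).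
have S0 : mul 0 =1 fun=> 0 by move=> x; have := mulB x 0 0; rewrite !subrr.
have vE : rsubmx v = slope_line (Some 0) (lsubmx (rsubmx v))
    + slope_line None (rsubmx (rsubmx v)).
  by rewrite /= add_row_mx S0 addr0 add0r hsubmxK.
have [k1 k1E] := const (lsubmx (rsubmx v)); have [k2 k2E] := const (rsubmx (rsubmx v)).
have n0 (x : 'rV[F]_m) k : x = k *: const_mx 1 -> x != 0 -> k != 0.
  by move=> ->; apply: contraNneq => ->; rewrite scale0r.
(* On the two axes the slopes [Some 0] and [None], which [beta] attains, suffice; off the axes both
   extra columns get nonzero coefficients. *)
have [x0|x0] := eqVneq (lsubmx (rsubmx v)) 0.
  rewrite vE x0 slope_line0 add0r; apply: one_slope b2 _ _.
  by apply: contraNneq v0 => y0; rewrite -[v]hsubmxK a0 vE x0 y0 !slope_line0 addr0 row_mx0.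
have [y0|y0] := eqVneq (rsubmx (rsubmx v)) 0.
  by rewrite vE y0 slope_line0 addr0; apply: one_slope b1 _ x0.
exists (inr true), (inr false), k1, k2; split=> //; rewrite ?(n0 _ _ k1E) ?(n0 _ _ k2E) //.
by rewrite vE k1E k2E !slope_lineZ /extended_col !scale_row_mx !add_row_mx !scaler0 !addr0.
Qed.

End Lift.

(** * Coloured families in all codimensions *)

(* The length in codimension [2 * t + 1]. *)
Definition code_length (p t : nat) : nat :=
  (2 * (p ^ 3 + p ^ 2 + p + 1) * (p ^ 6) ^ (t - 1) +
   (if (2 <= t)%N then 2 * (p ^ 6) ^ (t - 2) else 0))%N.

Lemma code_length_add p t m : (2 <= t)%N ->
  code_length p (t + m) = (code_length p t * (p ^ 6) ^ m)%N.
Proof.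
move=> t2; rewrite /code_length t2 (leq_trans t2) ?leq_addr // mulnDl -!mulnA -!expnD.
by rewrite !addnBAC // ltnW.
Qed.

(** The left side counts the colours in codimension 5: twice the number of plane columns, plus
    two. *)
Lemma plane_size_bound p : (1 < p)%N -> (4 * (p ^ 3 + p ^ 2 + p + 1) + 2 <= p ^ 6)%N.
Proof.
move=> p1; have p3 : (8 <= p ^ 3)%N by rewrite -[8%N]/(2 ^ 3)%N leq_exp2r.
have : (p ^ 2 + p + 1 < p ^ 3)%N by rewrite !expnS expn0; nia.
rewrite (expnM p 3 2); move: (p ^ 3)%N (p ^ 2)%N p3 => c b; nia.
Qed.

(** The lower bound provides enough columns for [beta] to be onto; the upper bound excludes covering
    radius 1. *)
Lemma leq_code_length p t : (1 < p)%N -> (0 < t)%N ->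
  ((p ^ 6) ^ (t - 1) + 1 <= code_length p t <= (p ^ 6) ^ t)%N.
Proof.
move=> p1 t0; have := plane_size_bound p1; have q0 e : (0 < (p ^ 6) ^ e)%N.
  by rewrite !expn_gt0 ltnW.
have -> : ((p ^ 6) ^ t = (p ^ 6) ^ (t - 1) * p ^ 6)%N by rewrite -expnSr subn1 prednK.
rewrite /code_length.
move: (q0 (t - 1)%N) => {}q0.
have : ((if 1 < t then 2 * (p ^ 6) ^ (t - 2) else 0) <= 2 * (p ^ 6) ^ (t - 1))%N.
  by case: ifP => // _; rewrite leq_mul2l leq_pexp2l ?expn_gt0 ?leq_sub2l // ltnW.
move: (if _ then _ else _) ((p ^ 6) ^ (t - 1))%N q0 => x y.
move: (p ^ 3 + p ^ 2 + p)%N (p ^ 6)%N => a q; nia.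
Qed.

Section Family.

Variables (F : finFieldType) (p : nat).
Hypotheses (pF : p \in [pchar F]) (cF : #|F| = (p ^ 6)%N).
Let p_prime : prime p := pcharf_prime pF.
Let p_gt1 : (1 < p)%N := prime_gt1 p_prime.
Local Notation q := (p ^ 6)%N.

Lemma plane_family : exists (J : finType) (h : J -> 'rV[F]_3),
  #|J| = code_length p 1 /\ spread h id.
Proof.
have [J [h [leJ hJ]]] := plane_spread pF cF.
(* Zero columns pad the set to the exact length. *)
pose pad := 'I_(2 * (p ^ 3 + p ^ 2 + p + 1) - #|J|).
exists (J + pad)%type, (fun i => if i is inl j then h j else 0); split.
  by rewrite card_sum card_ord subnKC // /code_length expn0 muln1 addn0.
by move=> a /hJ[i [j [x [y [x0 y0 ij e]]]]]; exists (inl i), (inl j), x, y.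
Qed.

(** Each concatenation doubles the colours and increases [t] by at least 1, so the bound
    [q * 2 ^ (t - 2)] persists. Keeping [r] as a variable with an equation avoids casts between
    matrix sizes. *)
Definition colored_family t := exists (r : nat) (J T : finType) (h : J -> 'rV[F]_r)
  (col : J -> T), [/\ r = (2 * t + 1)%N, #|J| = code_length p t,
                      (#|T| <= q * 2 ^ (t - 2))%N & spread h col].

(** [B] is listed with [b1] and [b2] first, so that they are the images of the elements of rank 0
    and 1. *)
Lemma injection_through (J B : finType) (b1 b2 : B) : b1 != b2 ->
    (1 < #|J|)%N -> (#|J| <= #|B|)%N ->
  exists beta : J -> B, [/\ injective beta, exists j, beta j = b1 & exists j, beta j = b2].
Proof.
move=> b12 J1 leJB; pose s := [:: b1, b2 & [seq b <- enum B | (b != b1) && (b != b2)]].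
have us : uniq s.
  by rewrite /= !inE !mem_filter !eqxx /= !andbF orbF b12 filter_uniq ?enum_uniq.
have ss : size s = #|B|.
  rewrite -(card_uniqP us); apply: eq_card => b; rewrite !inE mem_filter mem_enum andbT.
  by case: eqP; case: eqP.
exists (fun j => nth b1 s (enum_rank j)); split.
- move=> i j /eqP; rewrite nth_uniq ?ss ?(leq_trans (ltn_ord _)) ?cardT -?cardT //.
  by move/eqP/val_inj/enum_rank_inj.
- by exists (enum_val (Ordinal (ltnW J1))); rewrite enum_valK.
- by exists (enum_val (Ordinal J1)); rewrite enum_valK.
Qed.

Lemma colored_family2 : colored_family 2.
Proof.
have [J [h [cJ hJ]]] := plane_family.
have [mul [mulL mulB mul0]] := presemifield_exists F (isT : (0 < 1)%N).
have cB : #|{: option 'rV[F]_1}| = q.+1 by rewrite card_option card_mx cF expn1.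
have l1 : code_length p 1 = (2 * (p ^ 3 + p ^ 2 + p + 1))%N.
  by rewrite /code_length expn0 muln1 addn0.
have bd := plane_size_bound p_gt1; rewrite l1 in cJ.
have J1 : (1 < #|J|)%N by rewrite cJ; lia.
have leJB : (#|J| <= #|{: option 'rV[F]_1}|)%N.
  rewrite cJ cB; move: bd; move: (p ^ 3 + p ^ 2 + p + 1)%N q => a b; lia.
have [beta [beta_inj b1 b2]] :=
  injection_through (isT : Some 0 != None :> option 'rV[F]_1) J1 leJB.
exists (3 + (1 + 1))%N, (J * 'rV[F]_1 + bool)%type, (J * bool + bool)%type,
  (extended_col mul h beta), (extended_color (m:=1) id); split=> //.
- by rewrite card_sum card_prod card_mx card_bool cJ cF /code_length expn0 !mul1n !expn1 muln1.
- rewrite card_sum card_prod card_bool cJ expn0 muln1; move: bd.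
  by move: (p ^ 3 + p ^ 2 + p + 1)%N q => a b; lia.
by apply: extended_spread => // i j /beta_inj.
Qed.

(** With [q >= 2^6], the condition [t - 2 <= 6 (m - 1)] gives at most [q^m] colours, and [m < t]
    gives at least [q^m + 1] columns. *)
Lemma colored_family_add t m : (2 <= t)%N -> (0 < m)%N -> (m < t)%N ->
  (t - 2 <= 6 * (m - 1))%N -> colored_family t -> colored_family (t + m).
Proof.
move=> t2 m0 mt tm [r [J [T [h [col [r_def cJ leT hJ]]]]]].
have [mul [mulL mulB mul0]] := presemifield_exists F m0.
have cB : #|{: option 'rV[F]_m}| = (q ^ m).+1 by rewrite card_option card_mx cF mul1n.
have q_gt0 : (0 < q)%N by rewrite expn_gt0 ltnW.
have leTB : (#|T| <= #|{: option 'rV[F]_m}|)%N.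
  rewrite cB ltnW // ltnS (leq_trans leT) //.
  have -> : (q ^ m = q * q ^ (m - 1))%N by rewrite -expnS subn1 prednK.
  rewrite leq_mul2l (leq_trans (leq_pexp2l (isT : (0 < 2)%N) tm)) ?orbT //.
  by rewrite expnM; case: (m - 1)%N => // e; rewrite !leq_exp2r.
have leBJ : (#|{: option 'rV[F]_m}| <= #|J|)%N.
  have /andP[] := leq_code_length p_gt1 (ltnW t2); rewrite cB cJ addn1 => + _.
  by apply: leq_trans; rewrite ltnS leq_pexp2l // -ltnS subn1 prednK // ltnW.
have [|beta [beta_surj beta_sep]] := coloring_refinement col _ leTB leBJ.
  by rewrite cB.
exists (r + (m + m))%N, (J * 'rV[F]_m)%type, (T * bool)%type, (lift_col mul h beta),
  (fun u => (col u.1, u.2 == 0)); split.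
- by rewrite r_def; lia.
- by rewrite card_prod card_mx cF mul1n cJ code_length_add.
- rewrite card_prod card_bool; have -> : (t + m - 2 = (t - 2) + m)%N by lia.
  rewrite expnD mulnA leq_mul //; case: (m) m0 => // m' _.
  by rewrite expnS leq_pmulr ?expn_gt0.
by apply: lift_spread.
Qed.

Lemma colored_family_exists t : (2 <= t)%N -> t <> 4 -> t <> 6 -> colored_family t.
Proof.
elim/ltn_ind: t => t IH t2 t4 t6.
have step s m : (s + m)%N = t -> (2 <= s)%N -> s <> 4 -> s <> 6 -> (0 < m)%N ->
    (m < s)%N -> (s - 2 <= 6 * (m - 1))%N -> colored_family t.
  move=> st s2 s4 s6 m0 ms sm; rewrite -st; apply: colored_family_add => //.
  by apply: IH => //; lia.
have [t10|t10] := leqP 10 t.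
  (* This choice keeps [t - m] at least 7, away from the excluded values 4 and 6. *)
  pose m := ((t - 3) %/ 2)%N.
  have : (t - 4 <= 2 * m <= t - 3)%N by rewrite /m; lia.
  by move: (m) => {}m bm; apply: (step (t - m)%N m); lia.
have : t \in [:: 2; 3; 5; 7; 8; 9] by rewrite !inE; lia.
rewrite !inE; case/or4P; last case/or3P; move/eqP=> t_def.
- by rewrite t_def; apply: colored_family2.
- by apply: (step 2 1) => //; rewrite t_def.
- by apply: (step 3 2) => //; rewrite t_def.
- by apply: (step 5 2) => //; rewrite t_def.
- by apply: (step 5 3) => //; rewrite t_def.
- by apply: (step 5 4) => //; rewrite t_def.
Qed.

End Family.

(** * Codes and covering density *)

From mathcomp Require Import all_classical all_reals all_analysis.
Import Order.TTheory GRing.Theory Num.Theory.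

Section CodeOfMatrix.

Variables (F : finFieldType) (n r : nat) (H : 'M[F]_(r, n)).

Lemma covers_row_free R : covers H R -> exists B, H *m B = 1%:M.
Proof.
move=> cov; apply/row_freeP/inj_row_free => v vH; apply/rowP => i.
have [I [c [_ e]]] := cov (delta_mx i 0).
have : v *m delta_mx i (0 : 'I_1) = 0.
  rewrite e mulmx_sumr big1 // => j _.
  by rewrite -scalemxAr colE mulmxA vH mul0mx scaler0.
by rewrite -colE => /colP/(_ 0); rewrite !mxE.
Qed.

(** With [R <= 1], scalar multiples of single columns would exhaust the space, but there are at most
    [n * #|F|] of them. *)
Lemma covers_radius_ge2 R :
  (0 < n)%N -> (n * #|F| < #|F| ^ r)%N -> covers H R -> (2 <= R)%N.
Proof.
move=> n_gt0 small cov; rewrite leqNgt; apply/negP => R1.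
move: small; rewrite ltnNge => /negP; apply.
pose f (u : 'I_n * F) := u.2 *: col u.1 H.
have -> : (#|F| ^ r)%N = #|{: 'cV[F]_r}| by rewrite card_mx muln1.
have f_surj s : exists u, f u = s.
  have [I [c [cI ->]]] := cov s; have I1 := leq_trans cI R1.
  case cardI: #|I| I1 => [|[|//]] _.
    by exists (Ordinal n_gt0, 0); rewrite (cards0_eq cardI) big_set0 /f scale0r.
  have /cards1P[i ->] : #|I| == 1%N by rewrite cardI.
  by exists (i, c i); rewrite big_set1.
have -> : (n * #|F|)%N = #|{: 'I_n * F}| by rewrite card_prod card_ord.
have /fin_all_exists[g gK] := f_surj.
by apply: (leq_card g); apply: can_inj gK.
Qed.

Lemma covers_code : (0 < n)%N -> covers H 2 -> (n * #|F| < #|F| ^ r)%N ->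
  exists C : {vspace 'rV[F]_n}, is_linear_code r C 2.
Proof.
move=> n_gt0 cov small; have [B HB] := covers_row_free cov.
pose f := linfun (mulmx H \o @trmx F 1 n).
have fE x : f x = H *m x^T.
  by rewrite lfunE.
exists (lker f); split; last first.
  exists H; split=> //; last by move=> R'; apply: covers_radius_ge2.
  split; first by apply/row_freeP; exists B.
  by move=> x; rewrite memv_ker fE.
have := limg_ker_dim f fullv; rewrite capfv.
have -> : (f @: fullv = fullv)%VS.
  apply/eqP; rewrite eqEsubv subvf; apply/subvP => s _.
  have <- : f (B *m s)^T = s by rewrite fE trmxK mulmxA HB mul1mx.
  exact/memv_img/memvf.
by rewrite !dimvf /dim /= muln1 mul1n.
Qed.

End CodeOfMatrix.

Lemma spread_covers (F : finFieldType) r (J : finType) (T : eqType)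
    (h : J -> 'rV[F]_r) (col : J -> T) : spread h col ->
  covers (\matrix_(i < r, j < #|J|) h (enum_val j) 0 i) 2.
Proof.
move=> hJ s; have [s0|s0] := eqVneq s 0.
  (* [spread] says nothing about the zero vector, which is the empty combination. *)
  by exists finset.set0, (fun=> 0); rewrite cards0 big_set0.
have [|i [j [x [y [x0 y0 ij e]]]]] := hJ s^T.
  by apply: contraNneq s0 => /(congr1 trmx); rewrite trmxK trmx0 => ->.
have rij : enum_rank i != enum_rank j.
  by apply: contraNneq ij => /enum_rank_inj->.
exists [set enum_rank i; enum_rank j]%SET, (fun l => if l == enum_rank i then x else y).
rewrite cards2 rij big_setU1 ?inE //= big_set1 eqxx eq_sym (negPf rij); split=> //.
apply/colP => l; move/rowP/(_ l): e; rewrite !mxE => ->.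
by rewrite !enum_rankK.
Qed.

Lemma spread_code (F : finFieldType) (n r : nat) (J : finType) (T : eqType)
    (h : J -> 'rV[F]_r) (col : J -> T) :
  #|J| = n -> (0 < n)%N -> (n * #|F| < #|F| ^ r)%N -> spread h col ->
  exists C : {vspace 'rV[F]_n}, is_linear_code r C 2.
Proof. by move=> <- n0 small /spread_covers cov; apply: covers_code n0 cov small. Qed.

Section Codes.
Variables (F : finFieldType) (p : nat).
Hypotheses (p_prime : prime p) (cF : #|F| = (p ^ 6)%N).

Lemma code_exists t : (1 <= t)%N -> t <> 4%N -> t <> 6%N ->
  exists C : {vspace 'rV[F]_(code_length p t)}, is_linear_code (2 * t + 1) C 2.
Proof.
move=> t1 t4 t6; have p1 := prime_gt1 p_prime.
have pF : p \in [pchar F] := card_finPcharP cF p_prime.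
have /andP[len_lo len_hi] := leq_code_length p1 t1.
have len0 : (0 < code_length p t)%N by rewrite (leq_trans _ len_lo) // addn1.
have q1 : (1 < #|F|)%N := finNzRing_gt1 F.
have small : (code_length p t * #|F| < #|F| ^ (2 * t + 1))%N.
  rewrite addn1 expnSr ltn_pmul2r ?(ltn_trans _ q1) // (leq_ltn_trans len_hi) //.
  by rewrite cF ltn_exp2l -?cF //; lia.
have [t2|t2] := leqP 2 t.
  have [r [J [T [h [col [r_def cJ _ hJ]]]]]] := colored_family_exists pF cF t2 t4 t6.
  by rewrite -r_def in small *; apply: spread_code hJ.
have -> : t = 1%N by lia.
have [J [h [cJ hJ]]] := plane_family pF cF.
apply: (spread_code cJ _ _ hJ); last by move: small; have -> : t = 1%N by lia.
by move: len0; have -> : t = 1%N by lia.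
Qed.

End Codes.

(** * The length formula and the limit of the density *)

Section Reals.
Import numFieldNormedType.Exports.
Variables (K : realType) (p : nat).
Hypothesis p_gt1 : (1 < p)%N.
Local Notation P := (p%:R : K).
Local Notation q := ((p ^ 6)%N%:R : K).

Let P0 : 0 < P. Proof. by rewrite ltr0n ltnW. Qed.
Let P2 : 2 <= P. Proof. by rewrite (ler_nat _ 2). Qed.

Lemma nroot_exp k e : (0 < k)%N -> nroot k (P ^+ (k * e)) = P ^+ e.
Proof.
move=> k0; rewrite /nroot mulnC exprM -powR_mulrn ?exprn_ge0 ?ltW // -powRrM.
by rewrite divff ?pnatr_eq0 ?gtn_eqF // powRr1 // exprn_ge0 // ltW.
Qed.

Lemma code_length_real t : (1 <= t)%N ->
  (code_length p t)%:R =
    (2 + 2 / nroot 6 q + 2 / nroot 3 q + 2 / Num.sqrt q) * q `^ (((2 * t + 1)%N%:R - 2) / 2)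
    + 2 * (Num.floor (q `^ (((2 * t + 1)%N%:R - 5) / 2) : K))%:~R :> K.
Proof.
move=> t1.
have qE : q = P ^+ 6 by rewrite natrX.
have -> : nroot 6 q = P by rewrite qE (@nroot_exp 6 1).
have -> : nroot 3 q = P ^+ 2 by rewrite qE (@nroot_exp 3 2).
have -> : Num.sqrt q = P ^+ 3.
  by rewrite qE (exprM P 3 2) sqrtr_sqr ger0_norm // exprn_ge0 // ltW.
have powq (x : K) : q `^ x = P `^ (6%:R * x).
  by rewrite qE -powR_mulrn ?ltW // -powRrM.
have -> : q `^ (((2 * t + 1)%:R - 2) / 2) = P ^+ 3 * q ^+ (t - 1).
  rewrite powq qE -exprM -exprD -powR_mulrn ?ltW //; congr (_ `^ _).
  by rewrite -{1}(subnK t1); move: (t - 1)%N => u; field.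
have floorE : (Num.floor (q `^ (((2 * t + 1)%:R - 5) / 2) : K))%:~R =
    (if (2 <= t)%N then (p ^ 6) ^ (t - 2) else 0)%N%:R :> K.
  case: ifP => t2.
    have -> : q `^ (((2 * t + 1)%:R - 5) / 2) = ((p ^ 6) ^ (t - 2))%N%:R.
      rewrite powq natrX qE -exprM -[RHS]powR_mulrn ?ltW //; congr (_ `^ _).
      by rewrite -{1}(subnK t2); move: (t - 2)%N => u; field.
    by rewrite floorK ?natr_int.
  (* For [r = 3] the power is [1 / q], whose floor is 0. *)
  have -> : t = 1%N by lia.
  have -> : ((2 * 1 + 1)%:R - 5) / 2 = -1 :> K by field.
  rewrite (@floor_def _ _ 0) // powR_inv1 // invr_ge0 ler0n add0r /=.
  have q1 : (1 < p ^ 6)%N by rewrite -(exp1n 6) ltn_exp2r.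
  by rewrite invf_lt1 ?ltr1n ?ltr0n // ltnW.
rewrite floorE /code_length natrD natrM [X in _ + X = _](_ : _ =
  2 * (if (2 <= t)%N then (p ^ 6) ^ (t - 2) else 0)%N%:R); last first.
  by case: ifP => _; rewrite ?natrM ?mulr0.
congr (_ + _); rewrite natrX; move: (q ^+ _) => y; field.
by rewrite gt_eqF.
Qed.


(** For [t >= 2] the length is [d q^t] with [d = code_length p 2 / q^2]; this is the leading
    coefficient of the [i = 2] term. *)
Definition density_limit : K :=
  (q - 1) ^+ 2 * ((code_length p 2)%:R / q ^+ 2) ^+ 2 / (2 * q).

Lemma density_limit_lt : density_limit <
  2 + 4 / nroot 6 q + 6 / nroot 3 q + 8 / Num.sqrt q
    + 6 / nroot 3 (q ^+ 2) + 5 / nroot 6 (q ^+ 5).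
Proof.
have qE : q = P ^+ 6 by rewrite natrX.
have -> : nroot 6 q = P by rewrite qE (@nroot_exp 6 1).
have -> : nroot 3 q = P ^+ 2 by rewrite qE (@nroot_exp 3 2).
have -> : Num.sqrt q = P ^+ 3.
  by rewrite qE (exprM P 3 2) sqrtr_sqr ger0_norm // exprn_ge0 // ltW.
have -> : nroot 3 (q ^+ 2) = P ^+ 4 by rewrite qE -exprM (@nroot_exp 3 4).
have -> : nroot 6 (q ^+ 5) = P ^+ 5 by rewrite qE -exprM (@nroot_exp 6 5).
pose S := P ^+ 3 + P ^+ 2 + P + 1.
have lenE : (code_length p 2)%:R = 2 * S * q + 2.
  by rewrite /code_length /= expn0 expn1 muln1 /S; ring.
rewrite /density_limit lenE qE; move: P0 P2; rewrite /S.
move: P => x x0 x2; set s := x ^+ 3 + x ^+ 2 + x + 1.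
have s1 : 1 <= s by rewrite /s; nra.
pose u := x ^+ 6; have u0 : 0 < u by rewrite exprn_gt0.
have u1 : 1 < u by rewrite /u exprn_egt1 //; lra.
have -> : (x ^+ 6 - 1) ^+ 2 * ((2 * s * x ^+ 6 + 2) / (x ^+ 6) ^+ 2) ^+ 2 / (2 * x ^+ 6)
  = 2 * ((u - 1) * (s * u + 1)) ^+ 2 / u ^+ 5.
  by rewrite /u; field; rewrite gt_eqF.
have -> : 2 + 4 / x + 6 / x ^+ 2 + 8 / x ^+ 3 + 6 / x ^+ 4 + 5 / x ^+ 5 =
   (2 * x ^+ 6 + 4 * x ^+ 5 + 6 * x ^+ 4 + 8 * x ^+ 3 + 6 * x ^+ 2 + 5 * x) / u.
  by rewrite /u; field; rewrite gt_eqF.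
apply: (@lt_le_trans _ _ (2 * (s * u ^+ 2) ^+ 2 / u ^+ 5)).
  rewrite ltr_pM2r ?invr_gt0 ?exprn_gt0 // ltr_pM2l //.
  have su : 0 <= (s - 1) * u by rewrite mulr_ge0 ?subr_ge0 // ltW.
  (* The difference of the two sides is [(s - 1) u + 1]. *)
  have lt1 : (u - 1) * (s * u + 1) < s * u ^+ 2 by lra.
  have ge0 : 0 <= (u - 1) * (s * u + 1).
    by rewrite mulr_ge0 ?subr_ge0 ?(ltW u1) // addr_ge0 // mulr_ge0 ?ltW // (lt_le_trans _ s1).
  by rewrite ltr_pXn2r // ?nnegrE // (le_trans ge0) // ltW.
have -> : 2 * (s * u ^+ 2) ^+ 2 / u ^+ 5 = 2 * s ^+ 2 / u by field; rewrite gt_eqF.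
rewrite ler_pM2r ?invr_gt0 //.
(* Only the tail [4 x + 2] differs from the target, and it is at most [5 x] since [x >= 2]. *)
have -> : 2 * s ^+ 2 =
    2 * x ^+ 6 + 4 * x ^+ 5 + 6 * x ^+ 4 + 8 * x ^+ 3 + 6 * x ^+ 2 + 4 * x + 2.
  by rewrite /s; ring.
lra.
Qed.

Lemma bin2_real n : 'C(n, 2)%:R = n%:R * (n%:R - 1) / 2 :> K.
Proof.
have : ('C(n, 2) * 2 = n * n.-1)%N by rewrite -[2%N in LHS]/(2`!) bin_ffact ffactnS ffactn1.
move/(congr1 (fun m => m%:R : K)); rewrite !natrM => e.
rewrite -[LHS](mulfK (_ : 2 != 0 :> K)) ?e ?pnatr_eq0 //; congr (_ / _).
by case: n {e} => [|n]; rewrite ?mul0r // -natr1 addrK.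
Qed.

Lemma density_cvg :
  (covering_density K (p ^ 6) (code_length p t) (2 * t + 1) 2 @[t --> \oo]
    --> density_limit)%classic.
Proof.
pose d : K := (code_length p 2)%:R / q ^+ 2.
have q1 : 1 < q by rewrite ltr1n -(exp1n 6) ltn_exp2r.
have q0 : 0 < q by apply: lt_trans q1.
(* [b] collects the terms linear in the length, from [i = 1] and from [n (n - 1) / 2]. The term
   [i = 0] gives the last summand of [g], which equals the density for every [t >= 2]. *)
pose b := (q - 1) * d / q - (q - 1) ^+ 2 * d / (2 * q).
pose g (t : nat) : K := density_limit + b * q^-1 ^+ t + q^-1 * (q^-1 ^+ t * q^-1 ^+ t).
have yc : (q^-1 ^+ t @[t --> \oo] --> (0 : K))%classic.
  by apply: cvg_expr; rewrite ger0_norm ?invr_ge0 ?ltW // invf_lt1.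
have gc : (g @ \oo --> density_limit)%classic.
  suff : (g @ \oo --> density_limit + b * 0 + q^-1 * (0 * 0))%classic.
    by rewrite !mulr0 !addr0.
  apply: cvgD; first by apply: cvgD; [exact: cvg_cst|apply: cvgMr].
  by apply: cvgMr; apply: cvgM.
apply: cvg_trans gc; apply: near_eq_cvg; exists 2%N => //= t t2.
rewrite /g /covering_density /sphere_volume.
rewrite big_nat_recr //= big_nat_recr //= big_nat1 expn0 bin0 mul1n expn1 bin1.
have nE : (code_length p t)%:R = d * q ^+ t.
  rewrite -{1}(subnKC t2) code_length_add // natrM natrX -{2}(subnKC t2) exprD /d.
  by field; rewrite gt_eqF.
have e1 : (p ^ 6 - 1)%N%:R = q - 1 :> K by rewrite natrB // expn_gt0 ltnW.
rewrite !natrD natrM natrM bin2_real (natrX K (p ^ 6 - 1)) e1 nE.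
rewrite [X in _ / X]exprD expr1 (mulnC 2) exprM exprVn /density_limit -/d /b.
move: q (q ^+ t) q0 (gt_eqF (exprn_gt0 t q0)) => z y z0 y0.
by field; rewrite y0 gt_eqF.
Qed.

End Reals.

Theorem theorem14 (K : realType) (q' q : nat) (F : finFieldType)
    (q'_prime : prime q') (q'_le73 : (q' <= 73)%N) (q_def : q = (q' ^ 6)%N)
    (cardF : #|F| = q) :
  exists n : nat -> nat,
    (forall r : nat, odd r -> (3 <= r)%N -> r <> 9%N -> r <> 13%N ->
       (n r)%:R =
         (2 + 2 / nroot 6 q%:R + 2 / nroot 3 q%:R + 2 / Num.sqrt q%:R)
           * q%:R `^ ((r%:R - 2) / 2)
         + 2 * (Num.floor (q%:R `^ ((r%:R - 5) / 2) : K))%:~R :> K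
       /\ exists C : {vspace 'rV[F]_(n r)}, is_linear_code r C 2)
    /\ (limn_einf (fun t : nat =>
           (covering_density K q (n (2 * t + 1)%N) (2 * t + 1) 2)%:E)
        < (2 + 4 / nroot 6 q%:R + 6 / nroot 3 q%:R + 8 / Num.sqrt q%:R
             + 6 / nroot 3 (q%:R ^+ 2) + 5 / nroot 6 (q%:R ^+ 5) : K)%:E)%E.
Proof.
subst q; have p1 := prime_gt1 q'_prime.
have halfE t : ((2 * t + 1)./2 = t)%N by rewrite mul2n addn1 /= uphalf_double.
exists (fun r => code_length q' r./2); split=> [r r_odd r3 r9 r13|].
  have [t rE] : exists t, r = (2 * t + 1)%N.
    by exists r./2; rewrite mul2n addn1 -[LHS](odd_double_half r) r_odd.
  have [t1 [t4 t6]] : (1 <= t)%N /\ t <> 4%N /\ t <> 6%N by lia.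
  rewrite rE halfE; split; first exact: code_length_real.
  exact: (code_exists q'_prime cardF t1 t4 t6).
under eq_fun do rewrite halfE.
have dc := @density_cvg K q' p1.
have /cvg_limn_einf_sup[-> _] : ((covering_density K (q' ^ 6)
  (code_length q' t) (2 * t + 1) 2)%:E @[t --> \oo] --> (density_limit K q')%:E)%classic.
  by apply: cvg_EFin => //; apply: nearW.
by rewrite lte_fin; apply: density_limit_lt.
Qed.
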